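(* Let $m \geq 1$ be an integer. Let $J$ be a $7\times 7$ Jacobi matrix that realizes perfect state transfer and whose spectrum is $\{0, \pm(2m+1), \pm(2m+2), \pm(2m+3)\}$. Then $J$ exhibits early state exclusion exactly $2m$ times, i.e., if $T>0$ is the earliest time at which $J$ realizes perfect state transfer, there are exactly $2m$ distinct times $\tau\in(0,T)$ with $\langle e^{-iJ\tau}\mathbf{e}_0,\mathbf{e}_0\rangle=0$.
   Context: A Jacobi matrix of order $N+1$ is a real symmetric tridiagonal matrix $J$ with diagonal entries $a_1,\dots,a_{N+1}\in\mathbb{R}$ and off-diagonal entries $b_1,\dots,b_N>0$ (so $J_{i,i}=a_i$, $J_{i,i+1}=J_{i+1,i}=b_i$, all other entries zero). Let $\{\mathbf{e}_k\}_{k=0}^{N}$ be the canonical basis of $\mathbb{C}^{N+1}$, with $\mathbf{e}_0=[1,0,\dots,0]^\top$ and $\mathbf{e}_N=[0,\dots,0,1]^\top$, and let $\langle\cdot,\cdot\rangle$ be the standard inner product on $\mathbb{C}^{N+1}$. $J$ realizes perfect state transfer (PST) at time $T>0$ if $e^{-iJT}\mathbf{e}_0 = e^{i\phi}\mathbf{e}_N$ for some $\phi\in\mathbb{R}$; ''$J$ realizes PST'' means this holds for some $T>0$. If $J$ realizes PST and $T>0$ is the earliest time at which it does, then $J$ exhibits early state exclusion (ESE) at time $\tau$ if $\tau\in(0,T)$ and $\langle e^{-iJ\tau}\mathbf{e}_0,\mathbf{e}_0\rangle = 0$. Here $N+1=7$. *)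

(* Defs.v *)
From HB Require Import structures.
From mathcomp Require Import all_boot all_order all_algebra.
From mathcomp Require Import all_classical all_reals all_analysis.
From mathcomp Require Import complex.
Import numFieldNormedType.Exports.
Set Implicit Arguments. Unset Strict Implicit. Unset Printing Implicit Defensive.
Import Order.TTheory GRing.Theory Num.Theory.
Local Open Scope ring_scope.
Local Open Scope complex_scope.

Definition jacobi (R : realType) (n : nat) (a : 'I_n.+1 -> R) (b : 'I_n -> R)
  : 'M[R]_n.+1 :=
  \matrix_(i, j)
    (if i == j then a i
     else if (j : nat) == i.+1 then (if insub (i : nat) is Some k then b k else 0)
     else if (i : nat) == j.+1 then (if insub (j : nat) is Some k then b k else 0)
     else 0).

Definition cmx (R : realType) (n : nat) (J : 'M[R]_n) : 'M[R[i]]_n :=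
  map_mx (fun x => x%:C) J.

Definition expmi_partial (R : realType) (n : nat) (J : 'M[R]_n.+1) (t : R)
  (N : nat) : 'M[R[i]]_n.+1 :=
  \sum_(k < N) ((- 'i * t%:C) ^+ k / (k`!)%:R) *: (cmx J) ^+ k.

Definition expmi (R : realType) (n : nat) (J : 'M[R]_n.+1) (t : R)
  : 'M[R[i]]_n.+1 :=
  \matrix_(i, j)
    ((limn (fun N => complex.Re (expmi_partial J t N i j))) +i*
     (limn (fun N => complex.Im (expmi_partial J t N i j)))).

Definition expi (R : realType) (phi : R) : R[i] := (cos phi) +i* (sin phi).

Definition evec {R : realType} {n : nat} (k : 'I_n.+1) : 'cV[R[i]]_n.+1 :=
  \col_(r < n.+1) (if r == k then 1 else 0).

Definition cdot (R : realType) (n : nat) (u v : 'cV[R[i]]_n) : R[i] :=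
  \sum_i u i 0 * (v i 0)^*.

Definition PST_at (R : realType) (n : nat) (J : 'M[R]_n.+1) (T : R) : Prop :=
  0 < T /\ exists phi : R, expmi J T *m evec ord0 = expi phi *: evec ord_max.

Definition realizes_PST (R : realType) (n : nat) (J : 'M[R]_n.+1) : Prop :=
  exists T, PST_at J T.

Definition earliest_PST (R : realType) (n : nat) (J : 'M[R]_n.+1) (T : R) : Prop :=
  PST_at J T /\ forall t, 0 < t < T -> ~ PST_at J t.

(* ESE at time tau (relative to the earliest PST time T) *)
Definition ESE_at (R : realType) (n : nat) (J : 'M[R]_n.+1) (T tau : R) : Prop :=
  0 < tau < T /\ cdot (expmi J tau *m evec ord0) (evec ord0) = 0.

(* Main.v *)
(* Let [D k = p'(lambda_k)] with [p] the characteristic polynomial of [J], and let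
   [E k] be the spectral projections, i.e. the Lagrange basis polynomials
   evaluated at [J], so that [exp(-iJt) = sum_k exp(-i lambda_k t) E k]. Since [J]
   is tridiagonal, the corner entry of [E k] is [b_1 ... b_6 / D k]. Perfect state
   transfer at [T] matches it with the nonnegative diagonal entry, which gives
   [E k 0 0 = b_1 ... b_6 / |D k|] and [exp(-i lambda_k T) = exp(i phi) sg (D k)];
   for this spectrum the earliest such [T] is [pi].
   With [N = 2m+2], the return amplitude is then an explicit combination of
   [1, cos (N-1)t, cos Nt, cos (N+1)t], a polynomial of degree [N+1] in [cos t]. It
   vanishes to order 3 at [cos t = -1], so it has at most [N-2 = 2m] zeros in
   [(0, pi)]; its signs alternate at [t = j pi/N] for [0 <= j <= N-2], so it has at
   least that many. *)
Require Import Defs.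
From HB Require Import structures.
From mathcomp Require Import all_boot all_order all_algebra.
From mathcomp Require Import all_classical all_reals all_analysis.
From mathcomp Require Import complex.
From mathcomp Require Import ring lra zify.
Import numFieldNormedType.Exports.
Import Order.TTheory GRing.Theory Num.Theory.
Set Implicit Arguments. Unset Strict Implicit. Unset Printing Implicit Defensive.
Local Open Scope ring_scope.

(** * Spectral projections *)

Section Spectral.
Variables (F : fieldType) (n : nat) (J : 'M[F]_n.+1) (lam : 'I_n.+1 -> F).
Hypothesis lam_inj : injective lam.
Hypothesis lam_eig : forall k, eigenvalue J (lam k).

Definition node_factor (k : 'I_n.+1) : F := \prod_(j | j != k) (lam k - lam j).

Definition lagrange_basis (k : 'I_n.+1) : {poly F} :=
  (node_factor k)^-1 *: \prod_(j | j != k) ('X - (lam j)%:P).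

Definition spec_proj (k : 'I_n.+1) : 'M[F]_n.+1 := horner_mx J (lagrange_basis k).

Lemma node_factor_neq0 k : node_factor k != 0.
Proof.
by apply/prodf_neq0 => j jk; rewrite subr_eq0 (inj_eq lam_inj) eq_sym.
Qed.

Lemma lagrange_basisE k l : (lagrange_basis k).[lam l] = (l == k)%:R.
Proof.
rewrite hornerZ horner_prod.
under eq_bigr do rewrite hornerXsubC.
have [->|lk] := eqVneq; first by rewrite mulVf ?node_factor_neq0.
by rewrite (bigD1 l) //= subrr mul0r mulr0.
Qed.

Lemma char_poly_spectrum : char_poly J = \prod_k ('X - (lam k)%:P).
Proof.
rewrite [LHS](@all_roots_prod_XsubC _ _ [seq lam k | k <- enum 'I_n.+1]).
- by rewrite (monicP (char_poly_monic J)) scale1r big_map big_enum.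
- by rewrite size_char_poly size_map size_enum_ord.
- by apply/allP => _ /mapP[k _ ->]; rewrite -eigenvalue_root_char.
- by rewrite uniq_rootsE map_inj_uniq ?enum_uniq.
Qed.

(** [q] and its Lagrange interpolant agree at all [n+1] eigenvalues, so their difference is a
    multiple of the characteristic polynomial, which kills [J] by Cayley-Hamilton. *)
Lemma horner_mx_spectral q : horner_mx J q = \sum_k q.[lam k] *: spec_proj k.
Proof.
have -> : \sum_k q.[lam k] *: spec_proj k =
    horner_mx J (\sum_k q.[lam k] *: lagrange_basis k).
  by rewrite rmorph_sum; apply: eq_bigr => k _; rewrite /= horner_mxZ.
apply/eqP; rewrite -subr_eq0 -rmorphB; set r := q - _.
suff /dvdpP[p ->] : char_poly J %| r by rewrite rmorphM /= Cayley_Hamilton mulr0.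
rewrite char_poly_spectrum -big_enum -(big_map lam xpredT (fun x => 'X - x%:P)).
apply: uniq_roots_dvdp; last by rewrite uniq_rootsE map_inj_uniq ?enum_uniq.
apply/allP => _ /mapP[k _ ->]; rewrite /root hornerD hornerN horner_sum subr_eq0.
rewrite (bigD1 k) //= hornerZ lagrange_basisE eqxx mulr1 big1 ?addr0 // => l lk.
by rewrite hornerZ lagrange_basisE eq_sym (negPf lk) mulr0.
Qed.

Lemma expmx_spectral i : J ^+ i = \sum_k lam k ^+ i *: spec_proj k.
Proof.
rewrite -{1}[J]horner_mx_X -rmorphXn /= horner_mx_spectral.
by apply: eq_bigr => k _; rewrite hornerXn.
Qed.

Lemma sum_spec_proj : \sum_k spec_proj k = 1%:M.
Proof.
rewrite -[RHS]/(J ^+ 0) expmx_spectral.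
by apply: eq_bigr => k _; rewrite scale1r.
Qed.

Lemma spec_projM k l : spec_proj k *m spec_proj l = (k == l)%:R *: spec_proj k.
Proof.
rewrite [_ *m _](_ : _ = horner_mx J (lagrange_basis k * lagrange_basis l));
  last by rewrite rmorphM.
rewrite horner_mx_spectral (bigD1 k) //= hornerM !lagrange_basisE eqxx mul1r.
rewrite big1 ?addr0 // => j jk.
by rewrite hornerM lagrange_basisE (negPf jk) mul0r scale0r.
Qed.

Lemma spec_proj_sym k : J^T = J -> (spec_proj k)^T = spec_proj k.
Proof.
move=> Jsym; rewrite /spec_proj; elim/poly_ind: (lagrange_basis k) => [|p c IH].
  by rewrite rmorph0 trmx0.
rewrite rmorphD rmorphM /= horner_mx_X horner_mx_C linearD /= tr_scalar_mx.
by rewrite trmx_mul IH Jsym; congr (_ + _); exact: comm_mx_horner.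
Qed.

(** The Lagrange polynomial has degree [n] and leading coefficient [1 / node_factor k]; at the entry
    [(i, j)] only its top power of [J] survives. *)
Lemma spec_proj_corner k i j : (forall e, (e < n)%N -> (J ^+ e) i j = 0) ->
  spec_proj k i j = (J ^+ n) i j / node_factor k.
Proof.
move=> J0; pose p := \prod_(j | j != k) ('X - (lam j)%:P).
have sp : size p = n.+1.
  rewrite /p -big_filter size_prod_XsubC -sum1_size big_filter.
  by rewrite (sum1_card (predC1 k)) cardC1 card_ord.
have pm : p \is monic by apply: monic_prod => l _; exact: monicXsubC.
rewrite /spec_proj /lagrange_basis horner_mxZ mxE mulrC -/p; congr (_ * _).
rewrite -[p]coefK poly_def rmorph_sum summxE sp big_ord_recr /= big1 ?add0r.
  have := monicP pm; rewrite lead_coefE sp /= => ->.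
  by rewrite scale1r rmorphXn /= horner_mx_X.
by move=> l _; rewrite horner_mxZ rmorphXn /= horner_mx_X mxE J0 ?mulr0.
Qed.

End Spectral.

(** A symmetric idempotent is its own square, so each diagonal entry is a sum of squares. *)
Lemma spec_proj_diag_ge0 (F : realFieldType) n (J : 'M[F]_n.+1) lam k i :
  injective lam -> (forall k, eigenvalue J (lam k)) -> J^T = J ->
  0 <= spec_proj J lam k i i.
Proof.
move=> inj eig Jsym.
have := spec_projM inj eig k k; rewrite eqxx scale1r => <-.
rewrite mxE sumr_ge0 // => j _.
have -> : spec_proj J lam k j i = spec_proj J lam k i j.
  by rewrite -[in LHS]spec_proj_sym // mxE.
by rewrite -expr2 sqr_ge0.
Qed.

(** * Powers of a Jacobi matrix *)

Section JacobiPowers.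
Variables (R : realType) (n : nat) (a : 'I_n.+1 -> R) (b : 'I_n -> R).

Lemma jacobi_sym : (jacobi a b)^T = jacobi a b.
Proof.
apply/matrixP => i j; rewrite !mxE eq_sym; case: eqVneq => [->//|ij].
by case: eqVneq => // ji; case: eqVneq => // ij'; move: ji; rewrite ij'; lia.
Qed.

Lemma jacobi_far (i j : 'I_n.+1) : (i.+1 < j)%N -> jacobi a b i j = 0.
Proof.
move=> ij; rewrite mxE -val_eqE /=.
by do 3 (case: eqP => [|_]; first lia).
Qed.

(** A tridiagonal factor moves the index by at most one, so [e] factors cannot lead from [i] past
    [i + e]. *)
Lemma jacobi_expr_above (i j : 'I_n.+1) e : (i + e < j)%N -> (jacobi a b ^+ e) i j = 0.
Proof.
elim: e j => [|e IH] j ij.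
  by rewrite expr0 mxE -val_eqE /=; case: eqP => //; lia.
rewrite exprSr mxE big1 // => k _; have [ek|ke] := ltnP (i + e) k.
  by rewrite IH ?mul0r.
by rewrite jacobi_far ?mulr0 //; lia.
Qed.

(** The only path of length [e] from [i] to [i + e] goes up at every step, which makes the entry a
    product of [e] off-diagonal entries. *)
Lemma jacobi_expr_edge_gt0 (i j : 'I_n.+1) e : (forall k, 0 < b k) ->
  (i + e)%N = j -> 0 < (jacobi a b ^+ e) i j.
Proof.
move=> b0; elim: e j => [|e IH] j ij.
  by rewrite expr0 mxE -val_eqE /= -ij addn0 eqxx.
have en : (i + e < n.+1)%N by rewrite (leq_ltn_trans _ (ltn_ord j)) // -ij; lia.
have en' : (i + e < n)%N by have := ltn_ord j; lia.
pose l := Ordinal en.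
rewrite exprSr mxE (bigD1 l) //= big1 ?addr0.
  rewrite mulr_gt0 ?IH // mxE -val_eqE /=.
  case: eqP => [|_]; first lia.
  by rewrite -ij addnS eqxx insubT.
move=> k kl; have [ek|ke] := ltnP (i + e) k; first by rewrite jacobi_expr_above ?mul0r.
rewrite jacobi_far ?mulr0 //; move: kl; rewrite -val_eqE /=; lia.
Qed.

End JacobiPowers.

(** * The exponential of a matrix with simple spectrum *)

Section Exponential.
Local Open Scope classical_set_scope.
Local Open Scope complex_scope.
Variable R : realType.

Lemma cvg_series_cos_coeff (x : R) : series (cos_coeff x) @ \oo --> cos x.
Proof. by rewrite cos.unlock; exact: is_cvg_series_cos_coeff. Qed.

Lemma cvg_series_sin_coeff (x : R) : series (sin_coeff x) @ \oo --> sin x.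
Proof. by rewrite sin.unlock; exact: is_cvg_series_sin_coeff. Qed.

Lemma expC_coeff (x : R) k : (- 'i * x%:C) ^+ k / (k`!)%:R =
  (cos_coeff x k) -i* (sin_coeff x k).
Proof.
have kf : (k`!%:R : R[i])^-1 = (k`!%:R^-1)%:C by rewrite fmorphV rmorph_nat.
have powE : (- 'i * x%:C) ^+ k =
   ((~~ odd k)%:R * (-1) ^+ k./2 * x ^+ k) -i* ((odd k)%:R * (-1) ^+ k.-1./2 * x ^+ k).
  elim/ltn_ind: k {kf} => -[_|[_|k IH]].
  - by apply/eqP; rewrite eq_complex /=; apply/andP; split; apply/eqP; rewrite ?expr0 /=; ring.
  - by apply/eqP; rewrite eq_complex /=; apply/andP; split; apply/eqP; ring.
  rewrite !exprS IH ?ltnS ?leqnSn // mulrA.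
  have -> : (- 'i * x%:C) * (- 'i * x%:C) = (- x ^+ 2)%:C.
    by apply/eqP; rewrite eq_complex /=; apply/andP; split; apply/eqP; ring.
  rewrite negbK; apply/eqP; rewrite eq_complex /=; apply/andP; split; apply/eqP.
    by rewrite exprS; ring.
  (* At [k = 0] the truncation in [k.-1] breaks the shift of the exponent, but there the parity
     factor is zero. *)
  case: k {IH} => [|k] /=; first ring.
  rewrite exprS; case: (odd k); rewrite /= ?exprS; ring.
rewrite powE kf /cos_coeff /sin_coeff /= -!exprnP.
by apply/eqP; rewrite eq_complex /=; apply/andP; split; apply/eqP; ring.
Qed.

Lemma sum_complex (I : Type) (r : seq I) (P : pred I) (f g : I -> R) :
  \sum_(i <- r | P i) (f i +i* g i) =
  (\sum_(i <- r | P i) f i) +i* (\sum_(i <- r | P i) g i).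
Proof.
by apply: (big_rec3 (fun x y z => x = y +i* z)) => // i x y z _ ->.
Qed.

Variables (n : nat) (J : 'M[R]_n.+1) (lam : 'I_n.+1 -> R).
Hypothesis lam_inj : injective lam.
Hypothesis lam_eig : forall k, eigenvalue J (lam k).
Let E := spec_proj J lam.

Lemma cmx_exp k : cmx J ^+ k = cmx (J ^+ k).
Proof. by rewrite [RHS](rmorphXn (map_mx (real_complex R))). Qed.

(** Exchanging the two sums reduces the matrix series to the scalar cosine and sine series at
    [lam l * t]. *)
Lemma expmi_partial_spectral t N i j : expmi_partial J t N i j =
  (\sum_l E l i j * series (cos_coeff (lam l * t)) N) -i*
  (\sum_l E l i j * series (sin_coeff (lam l * t)) N).
Proof.
rewrite /expmi_partial summxE.
transitivity (\sum_(k < N) \sum_l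
    (- 'i * t%:C) ^+ k / (k`!)%:R * (lam l ^+ k * E l i j)%:C).
  apply: eq_bigr => k _; rewrite mxE cmx_exp mxE (expmx_spectral lam_inj lam_eig).
  rewrite summxE rmorph_sum mulr_sumr; apply: eq_bigr => l _ /=.
  by rewrite mxE.
rewrite exchange_big /=.
have H l : \sum_(k < N) (- 'i * t%:C) ^+ k / (k`!)%:R * (lam l ^+ k * E l i j)%:C =
  (E l i j * series (cos_coeff (lam l * t)) N) -i*
  (E l i j * series (sin_coeff (lam l * t)) N).
  rewrite /series /= !big_mkord.
  transitivity ((E l i j)%:C * \sum_(k < N)
    ((cos_coeff (lam l * t) k) +i* - (sin_coeff (lam l * t) k))).
    rewrite mulr_sumr; apply: eq_bigr => k _; rewrite -expC_coeff.
    by rewrite !rmorphM rmorphXn /= !exprMn; ring.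
  rewrite sum_complex sumrN.
  by apply/eqP; rewrite eq_complex /=; apply/andP; split; apply/eqP; ring.
rewrite (eq_bigr _ (fun l _ => H l)).
by rewrite sum_complex -sumrN.
Qed.

Lemma expmi_spectral t : expmi J t = \sum_l expi (- (lam l * t)) *: cmx (E l).
Proof.
apply/matrixP => i j; rewrite /expmi mxE summxE.
(* [expmi] takes limits of the real and imaginary parts, so each needs its own proof of
   convergence. *)
have cvgC : (fun N => complex.Re (expmi_partial J t N i j)) @ \oo -->
    \sum_l E l i j * cos (lam l * t).
  under eq_fun => N do rewrite expmi_partial_spectral /=.
  apply: (cvg_big (op := +%R)) => [|l _]; first exact: add_continuous.
  apply: cvgM; first exact: cvg_cst.
  exact: cvg_series_cos_coeff.
have cvgS : (fun N => complex.Im (expmi_partial J t N i j)) @ \oo -->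
    - \sum_l E l i j * sin (lam l * t).
  under eq_fun => N do rewrite expmi_partial_spectral /=.
  apply: cvgN; apply: (cvg_big (op := +%R)) => [|l _]; first exact: add_continuous.
  apply: cvgM; first exact: cvg_cst.
  exact: cvg_series_sin_coeff.
rewrite (cvg_lim _ cvgC) // (cvg_lim _ cvgS) // -sumrN -sum_complex.
apply: eq_bigr => l _; rewrite !mxE /expi cosN sinN.
by apply/eqP; rewrite eq_complex /=; apply/andP; split; apply/eqP; ring.
Qed.
End Exponential.

(** * Perfect state transfer *)

Section ExpI.
Local Open Scope complex_scope.
Variable R : realType.

Lemma expiD (x y : R) : expi (x + y) = expi x * expi y.
Proof.
apply/eqP; rewrite eq_complex /= cosD sinD.
by apply/andP; split; apply/eqP; ring.
Qed.

Lemma expi0 : expi 0 = 1 :> R[i].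
Proof. by rewrite /expi cos0 sin0. Qed.

Lemma expi_natMpi k : expi (k%:R * pi) = (-1) ^+ k :> R[i].
Proof.
elim: k => [|k IH]; first by rewrite mul0r expi0.
rewrite -[k.+1]addn1 natrD mulrDl mul1r expiD IH exprD expr1; congr (_ * _).
by apply/eqP; rewrite eq_complex /= cospi sinpi oppr0 !eqxx.
Qed.

Lemma expi_neq0 (x : R) : expi x != 0.
Proof.
apply/eqP => x0; have := expiD x (- x).
by rewrite subrr expi0 x0 mul0r => /eqP; rewrite oner_eq0.
Qed.

(** Compare moduli: the squares of the real and imaginary parts are added. *)
Lemma expi_eq_scale (x y u v : R) : 0 <= u ->
  expi x * u%:C = expi y * v%:C -> u = `|v|.
Proof.
move=> u0 /eqP; rewrite eq_complex /= !mulr0 !subr0 => /andP[/eqP h1 /eqP h2].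
have : u ^+ 2 = v ^+ 2.
  rewrite -[LHS]mul1r -(cos2Dsin2 x) -[RHS]mul1r -(cos2Dsin2 y).
  move: h1 h2; rewrite !add0r => h1 h2.
  have : (cos x * u) ^+ 2 + (sin x * u) ^+ 2 = (cos y * v) ^+ 2 + (sin y * v) ^+ 2.
    by rewrite h1 h2.
  by rewrite !exprMn -!mulrDl.
by move/(congr1 Num.sqrt); rewrite !sqrtr_sqr ger0_norm.
Qed.

End ExpI.

Section PST.
Local Open Scope complex_scope.
Variables (R : realType) (n : nat) (a : 'I_n.+1 -> R) (b : 'I_n -> R).
Variable lam : 'I_n.+1 -> R.
Hypothesis b_gt0 : forall k, 0 < b k.
Hypothesis lam_inj : injective lam.
Let J := jacobi a b.
Hypothesis lam_eig : forall k, eigenvalue J (lam k).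
Let E := spec_proj J lam.
Let D := node_factor lam.
Let corner : R := (J ^+ n) ord0 ord_max.

Lemma corner_gt0 : 0 < corner.
Proof. exact: jacobi_expr_edge_gt0. Qed.

Lemma spec_proj_0N k : E k ord0 ord_max = corner / D k.
Proof. by apply: spec_proj_corner => // e en; exact: jacobi_expr_above. Qed.

(** Applying [E k] to both sides of the transfer equation isolates one eigenvalue, while the phase
    [phi] is common to all [k]. *)
Lemma PST_at_spec_proj T : PST_at J T -> exists phi : R, forall k,
  expi (- (lam k * T)) *: (cmx (E k) *m evec ord0) =
  expi phi *: (cmx (E k) *m evec ord_max).
Proof.
move=> [_ [phi P]]; exists phi => k.
rewrite [RHS]scalemxAr -P mulmxA (expmi_spectral lam_inj lam_eig) mulmx_sumr.
rewrite (bigD1 k) //= big1 ?addr0 => [|l lk].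
  rewrite -scalemxAr -scalemxAl; congr (_ *: (_ *m _)).
  by rewrite /cmx -map_mxM (spec_projM lam_inj lam_eig) eqxx scale1r.
rewrite -scalemxAr /cmx -map_mxM (spec_projM lam_inj lam_eig) eq_sym (negPf lk) scale0r.
by rewrite (map_mx0 (real_complex R)) scaler0.
Qed.

Lemma mulmx_evec (A : 'M[R]_n.+1) i k : (cmx A *m evec k) i 0 = (A i k)%:C.
Proof.
rewrite mxE (bigD1 k) //= big1 ?addr0 => [|l lk]; rewrite !mxE.
  by rewrite eqxx mulr1.
by rewrite (negPf lk) mulr0.
Qed.

Lemma scale_mulmx_evec c (A : 'M[R]_n.+1) i k :
  (c *: (cmx A *m evec k)) i 0 = c * (A i k)%:C.
Proof. by rewrite mxE mulmx_evec. Qed.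

(** The moduli of the first entries in [PST_at_spec_proj] give this, because the diagonal entry is
    nonnegative. *)
Lemma PST_at_diag T k : PST_at J T -> E k ord0 ord0 = corner / `|D k|.
Proof.
move=> /PST_at_spec_proj[phi /(_ k) /matrixP /(_ ord0 0)].
rewrite !scale_mulmx_evec => /expi_eq_scale -> //.
  by rewrite spec_proj_0N normrM normrV ?unitfE ?node_factor_neq0 // gtr0_norm ?corner_gt0.
exact: spec_proj_diag_ge0 (jacobi_sym a b).
Qed.

(** Dividing the first entries by the positive weight [corner / |D k|] leaves the phases. The second
    conclusion no longer mentions time and so can be carried over to other times. *)
Lemma PST_at_phase T : PST_at J T -> exists phi : R,
  (forall k, expi (- (lam k * T)) = expi phi * (Num.sg (D k))%:C) /\
  (forall k, cmx (E k) *m evec ord0 = (Num.sg (D k))%:C *: (cmx (E k) *m evec ord_max)).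
Proof.
move=> PT; have [phi P] := PST_at_spec_proj PT; exists phi.
have ph k : expi (- (lam k * T)) = expi phi * (Num.sg (D k))%:C.
  have Dk := node_factor_neq0 lam_inj k.
  have /matrixP/(_ ord0 0) := P k.
  rewrite !scale_mulmx_evec (PST_at_diag _ PT) spec_proj_0N => h.
  have w0 : (corner / `|D k|)%:C != 0 :> R[i].
    by rewrite fmorph_eq0 gt_eqF // divr_gt0 ?corner_gt0 ?normr_gt0.
  apply: (mulIf w0); rewrite h -mulrA -rmorphM; congr (_ * _%:C).
  by rewrite mulrCA; congr (_ * _); rewrite normrEsg invfM mulrA divff ?mul1r ?sgr_eq0.
split=> // k; have := P k; rewrite ph -scalerA => h.
have sgsg : (Num.sg (D k))%:C * (Num.sg (D k))%:C = 1 :> R[i].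
  by rewrite -rmorphM -expr2 sqr_sg node_factor_neq0.
apply: (scalerI (expi_neq0 phi)).
rewrite scalerA mulrC -scalerA -h !scalerA.
by rewrite mulrCA sgsg mulr1.
Qed.

(** The transfer at [T] supplies the time-free relation between the first and last columns of each
    [E k]; matching phases at [t] then add up to a transfer. *)
Lemma PST_at_of_phase T t phi : PST_at J T -> 0 < t ->
  (forall k, expi (- (lam k * t)) * (Num.sg (D k))%:C = expi phi) -> PST_at J t.
Proof.
move=> /PST_at_phase[_ [_ cols]] t0 ph; split=> //; exists phi.
rewrite (expmi_spectral lam_inj lam_eig) mulmx_suml.
rewrite (eq_bigr (fun k => expi phi *: (cmx (E k) *m evec ord_max))); last first.
  by move=> k _; rewrite -scalemxAl cols scalerA ph.
rewrite -scaler_sumr -mulmx_suml; congr (_ *: _).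
have -> : \sum_k cmx (E k) = cmx (\sum_k E k).
  by rewrite [RHS](raddf_sum (map_mx (real_complex R))).
by rewrite (sum_spec_proj lam_inj lam_eig) /cmx (map_mx1 (real_complex R)) mul1mx.
Qed.

Lemma return_amplitude T t : PST_at J T ->
  cdot (expmi J t *m evec ord0) (evec ord0) =
  corner%:C * \sum_k (`|D k|^-1)%:C * expi (- (lam k * t)).
Proof.
move=> PT; rewrite /cdot (bigD1 ord0) //= big1 ?addr0 => [|i i0]; last first.
  have -> : evec ord0 i 0 = 0 :> R[i] by rewrite mxE (negPf i0).
  by rewrite conjC0 mulr0.
have -> : evec ord0 (ord0 : 'I_n.+1) 0 = 1 :> R[i] by rewrite mxE eqxx.
rewrite conjC1 mulr1 (expmi_spectral lam_inj lam_eig) mulmx_suml summxE mulr_sumr.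
apply: eq_bigr => k _; rewrite -scalemxAl mxE mulmx_evec (PST_at_diag _ PT).
by rewrite rmorphM; ring.
Qed.

End PST.

(** * Zeros of the return amplitude *)

Fixpoint chebyshev {R : nzRingType} (k : nat) : {poly R} :=
  match k with
  | 0 => 1
  | k1.+1 => if k1 is k2.+1 then 'X *+ 2 * chebyshev k1 - chebyshev k2 else 'X
  end.

Lemma chebyshevSS (R : nzRingType) k :
  chebyshev k.+2 = 'X *+ 2 * chebyshev k.+1 - chebyshev k :> {poly R}.
Proof. by []. Qed.

Lemma size_chebyshev (R : nzRingType) k : (size (@chebyshev R k) <= k.+1)%N.
Proof.
suff: (size (@chebyshev R k) <= k.+1)%N && (size (@chebyshev R k.+1) <= k.+2)%N.
  by case/andP.
elim: k => [|k /andP[IH1 IH2]]; first by rewrite /= size_poly1 size_polyX.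
rewrite IH2 chebyshevSS (leq_trans (size_polyD _ _)) // size_polyN geq_max.
rewrite (leq_trans IH1) ?andbT; last by lia.
rewrite mulrnAl -scaler_nat (leq_trans (size_scale_leq _ _)) //.
by rewrite (leq_trans (size_polyMleq _ _)) // size_polyX.
Qed.

Lemma horner_chebyshev_cos (R : realType) k (t : R) :
  (chebyshev k).[cos t] = cos (k%:R * t).
Proof.
suff: (chebyshev k).[cos t] = cos (k%:R * t) /\
      (chebyshev k.+1).[cos t] = cos (k.+1%:R * t) by case.
elim: k => [|k [IH1 IH2]]; first by rewrite /= !hornerE cos0.
split=> //; rewrite chebyshevSS !(hornerE, hornerMn) IH1 IH2.
have -> : k.+2%:R * t = k.+1%:R * t + t by rewrite -[k.+2]addn1 natrD; ring.
have -> : k%:R * t = k.+1%:R * t - t by rewrite -[k.+1]addn1 natrD; ring.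
rewrite [cos (_ - t)]cosB [cos (_ + t)]cosD; ring.
Qed.

(** Taylor expansion at [-1] to second order, from the values [(-1)^k], [-(-1)^k k^2] and
    [(-1)^k k^2 (k^2 - 1) / 3] of the polynomial and its first two derivatives. The factor 6 clears
    the denominators. *)
Lemma chebyshev_expansion_N1 (R : comNzRingType) k :
  exists q : {poly R}, 6%:R * chebyshev k =
    (-1) ^+ k * (6%:R - 6%:R * k%:R ^+ 2 * ('X + 1)
                 + k%:R ^+ 2 * (k%:R ^+ 2 - 1) * ('X + 1) ^+ 2)
    + ('X + 1) ^+ 3 * q.
Proof.
suff [] : (exists q : {poly R}, 6%:R * chebyshev k =
    (-1) ^+ k * (6%:R - 6%:R * k%:R ^+ 2 * ('X + 1)
                 + k%:R ^+ 2 * (k%:R ^+ 2 - 1) * ('X + 1) ^+ 2)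
    + ('X + 1) ^+ 3 * q) /\
  (exists q : {poly R}, 6%:R * chebyshev k.+1 =
    (-1) ^+ k.+1 * (6%:R - 6%:R * k.+1%:R ^+ 2 * ('X + 1)
                 + k.+1%:R ^+ 2 * (k.+1%:R ^+ 2 - 1) * ('X + 1) ^+ 2)
    + ('X + 1) ^+ 3 * q) by [].
elim: k => [|k [[q1 E1] [q2 E2]]].
  by split; exists 0; rewrite /=; ring.
split; first by exists q2.
(* The last term is the cubic part that arises when [2X = 2(X + 1) - 2] multiplies the quadratic
   term for [k.+1]. *)
exists ('X *+ 2 * q2 - q1 - (-1) ^+ k * 2%:R * (k.+1%:R ^+ 2 * (k.+1%:R ^+ 2 - 1))).
rewrite chebyshevSS mulrBr mulrCA E1 E2 !exprS -[k.+2]addn1 -[k.+1]addn1 !natrD.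
ring.
Qed.

(** * The return amplitude as a polynomial in [cos t] *)

Section CosinePolynomial.
Variables (R : realType) (m : nat).
Let N : R := (2 * m + 2)%:R.

(* With the weights [1/|p'(lambda_k)|], [p] the characteristic polynomial, the
   sum of [exp(-i lambda_k t)/|p'(lambda_k)|] over the spectrum is this function
   divided by [4 N^2 (4 N^2 - 1) (N - 1)^2 (N + 1)^2]. *)
Definition amplitude (t : R) : R :=
  4 * (4 * N ^+ 2 - 1)
  + N * (2 * N + 1) * (N + 1) ^+ 2 * cos ((2 * m + 1)%:R * t)
  + 4 * (N ^+ 2 - 1) ^+ 2 * cos ((2 * m + 2)%:R * t)
  + N * (2 * N - 1) * (N - 1) ^+ 2 * cos ((2 * m + 3)%:R * t).

Let N_ge2 : 2 <= N.
Proof. by rewrite /N ler_nat; lia. Qed.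

(** This keeps the polynomial in [cos t] from being zero, so that its roots can be counted. *)
Lemma amplitude0_gt0 : 0 < amplitude 0.
Proof.
rewrite /amplitude !mulr0 cos0 !mulr1; move: N_ge2; set x := N => x2.
have h1 : 0 <= x * (2 * x + 1) * (x + 1) ^+ 2.
  by rewrite mulr_ge0 ?sqr_ge0 // mulr_ge0; lra.
have h2 : 0 <= x * (2 * x - 1) * (x - 1) ^+ 2.
  by rewrite mulr_ge0 ?sqr_ge0 // mulr_ge0; lra.
have h3 := sqr_ge0 (x ^+ 2 - 1).
nra.
Qed.

(** Expanding around the angle [N t] suits the points [j pi/N]: there [sin (N t)] vanishes and
    [cos (N t)] is a sign. *)
Lemma amplitudeE t : amplitude t = 16 * N ^+ 2 - 4
  + 4 * (N ^+ 2 * (N ^+ 2 + 2) * cos t + (N ^+ 2 - 1) ^+ 2) * cos (N * t)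
  + (10 * N ^+ 3 + 2 * N) * sin t * sin (N * t).
Proof.
rewrite /amplitude.
have -> : (2 * m + 1)%:R * t = N * t - t by rewrite /N !natrD; ring.
have -> : (2 * m + 3)%:R * t = N * t + t by rewrite /N !natrD; ring.
rewrite -/N [cos (_ - t)]cosB [cos (_ + t)]cosD; ring.
Qed.

(* The amplitude vanishes to order 6 at [t = pi], hence to order 3 in
   [cos t] at [-1]. *)
Lemma amplitude_cos : exists q : {poly R}, (size q <= 2 * m + 1)%N /\
  forall t, 6 * amplitude t = (cos t + 1) ^+ 3 * q.[cos t].
Proof.
pose M : {poly R} := (2 * m + 2)%:R.
pose P : {poly R} := 4 * (4 * M ^+ 2 - 1)
  + M * (2 * M + 1) * (M + 1) ^+ 2 * chebyshev (2 * m + 1)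
  + 4 * (M ^+ 2 - 1) ^+ 2 * chebyshev (2 * m + 2)
  + M * (2 * M - 1) * (M - 1) ^+ 2 * chebyshev (2 * m + 3).
have MC : M = N%:P by rewrite /M /N rmorph_nat.
have PE : P = (4 * (4 * N ^+ 2 - 1))%:P
  + (N * (2 * N + 1) * (N + 1) ^+ 2) *: chebyshev (2 * m + 1)
  + (4 * (N ^+ 2 - 1) ^+ 2) *: chebyshev (2 * m + 2)
  + (N * (2 * N - 1) * (N - 1) ^+ 2) *: chebyshev (2 * m + 3).
  by rewrite /P MC -!mul_polyC; ring.
have sP : (size P <= 2 * m + 4)%N.
  have sD (p q : {poly R}) k :
      (size p <= k)%N -> (size q <= k)%N -> (size (p + q)%R <= k)%N.
    by move=> pk qk; rewrite (leq_trans (size_polyD _ _)) // geq_max pk.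
  have sZ c k : (k <= 2 * m + 3)%N -> (size (c *: chebyshev k : {poly R}) <= 2 * m + 4)%N.
    move=> km; rewrite (leq_trans (size_scale_leq _ _)) //.
    by rewrite (leq_trans (size_chebyshev _ _)) // addnS.
  rewrite PE; do 3 (apply: (@sD _ _ _); last by apply: sZ; lia).
  by rewrite (leq_trans (size_polyC_leq1 _)) // addnS.
have PH t : P.[cos t] = amplitude t.
  by rewrite PE !hornerD !hornerZ hornerC !horner_chebyshev_cos.
(* The weights make the Taylor coefficients of orders 0, 1 and 2 at [-1] cancel; what remains is the
   same combination of the three remainders. *)
have [q qE] : exists q, 6%:R * P = ('X + 1) ^+ 3 * q.
  have [q1 E1] := chebyshev_expansion_N1 R (2 * m + 1).
  have [q2 E2] := chebyshev_expansion_N1 R (2 * m + 2).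
  have [q3 E3] := chebyshev_expansion_N1 R (2 * m + 3).
  exists (M * (2 * M + 1) * (M + 1) ^+ 2 * q1 + 4 * (M ^+ 2 - 1) ^+ 2 * q2
          + M * (2 * M - 1) * (M - 1) ^+ 2 * q3).
  have -> : 6%:R * P = 6%:R * (4 * (4 * M ^+ 2 - 1))
    + M * (2 * M + 1) * (M + 1) ^+ 2 * (6%:R * chebyshev (2 * m + 1))
    + 4 * (M ^+ 2 - 1) ^+ 2 * (6%:R * chebyshev (2 * m + 2))
    + M * (2 * M - 1) * (M - 1) ^+ 2 * (6%:R * chebyshev (2 * m + 3)).
    rewrite /P; ring.
  have sg k : (-1) ^+ (2 * m + k) = (-1) ^+ k :> {poly R}.
    by rewrite exprD exprM sqrrN !expr1n mul1r.
  rewrite E1 E2 E3 !sg /M !natrD.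
  ring.
exists q; split; last first.
  move=> t; have := congr1 (horner^~ (cos t)) qE.
  by rewrite mulr_natl hornerMn PH -mulr_natl => ->; rewrite !hornerE.
have [->|q0] := eqVneq q 0; first by rewrite size_poly0.
have X1 : 'X + 1 = 'X - (- 1)%:P :> {poly R} by rewrite polyCN polyC1 opprK.
have s4 : size (('X + 1) ^+ 3 : {poly R}) = 4%N by rewrite X1 size_exp_XsubC.
have mon : ('X + 1) ^+ 3 \is @monic R by rewrite X1 monic_exp // monicXsubC.
have := size_monicM mon q0; rewrite -qE s4 -polyC_natr mul_polyC => sq.
have : (size (6%:R *: P) <= 2 * m + 4)%N by rewrite (leq_trans (size_scale_leq _ _)).
by rewrite sq; lia.
Qed.

Lemma continuous_amplitude : continuous amplitude.
Proof.
have cc (c : R) (k : nat) : continuous (fun t : R => c * cos (k%:R * t)).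
  move=> t; apply: continuousM; first exact: cst_continuous.
  apply: continuous_comp; last exact: continuous_cos.
  by apply: continuousM; [exact: cst_continuous | exact: cvg_id].
by move=> t; do 3 (apply: cvgD; last exact: cc); exact: cvg_cst.
Qed.

End CosinePolynomial.

Lemma sinMn_le (R : realType) k (x : R) : `|sin (k%:R * x)| <= k%:R * `|sin x|.
Proof.
elim: k => [|k IH]; first by rewrite mulr0n !mul0r sin0 normr0.
have -> : k.+1%:R * x = k%:R * x + x by rewrite -[k.+1]addn1 natrD; ring.
rewrite sinD (le_trans (ler_normD _ _)) // !normrM -[k.+1]addn1 natrD mulrDl mul1r.
apply: lerD.
  by rewrite -[leRHS]mulr1; apply: ler_pM => //; exact: cos_max.
by rewrite -[leRHS]mul1r; apply: ler_pM => //; exact: cos_max.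
Qed.

Lemma cos_natMpi (R : realType) k : cos (k%:R * pi) = (-1) ^+ k :> R.
Proof.
elim: k => [|k IH]; first by rewrite mulr0n mul0r cos0.
have -> : k.+1%:R * pi = k%:R * pi + pi :> R by rewrite -[k.+1]addn1 natrD; ring.
by rewrite cosDpi IH exprS mulN1r.
Qed.

Lemma sin_natMpi (R : realType) k : sin (k%:R * pi) = 0 :> R.
Proof.
elim: k => [|k IH]; first by rewrite mulr0n mul0r sin0.
have -> : k.+1%:R * pi = k%:R * pi + pi :> R by rewrite -[k.+1]addn1 natrD; ring.
by rewrite sinDpi IH oppr0.
Qed.

(** * Zeros from sign changes, and a bound from the degree *)

Section AmplitudeZeros.
Variables (R : realType) (m : nat).
Let N : R := (2 * m + 2)%:R.
Let node (j : nat) : R := j%:R * pi / N.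

Let N_gt0 : 0 < N.
Proof. by rewrite ltr0n; lia. Qed.

Let node_lt i j : (i < j)%N -> node i < node j.
Proof. by move=> ij; rewrite ltr_pM2r ?invr_gt0 // ltr_pM2r ?pi_gt0 // ltr_nat. Qed.

Let node_le i j : (i <= j)%N -> node i <= node j.
Proof. by rewrite leq_eqVlt => /predU1P[->//|/node_lt/ltW]. Qed.

Let node0 : node 0 = 0.
Proof. by rewrite /node !mul0r. Qed.

Let node_pi : node (2 * m + 2) = pi.
Proof. by rewrite /node mulrAC divff ?mul1r // gt_eqF. Qed.

(* [1 = sin ((m+1) pi/N) <= (m+1) sin (pi/N)]. *)
Let sin_node1 : 2 <= N * sin (node 1).
Proof.
have := @sinMn_le R m.+1 (node 1).
have -> : m.+1%:R * node 1 = pi / 2.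
  have NE : N = m.+1%:R * 2 by rewrite /N -natrM; congr _%:R; lia.
  rewrite /node NE; field.
  by rewrite nat1r pnatr_eq0.
have s0 : 0 <= sin (node 1).
  by rewrite sin_ge0_pi // -[X in X <= _]node0 -node_pi !node_le //; lia.
rewrite sin_pihalf normr1 (ger0_norm s0).
have -> : N = m.+1%:R *+ 2 by rewrite /N -mulrnA; congr _%:R; lia.
lra.
Qed.

(** Cosine decreases on [[0, pi]], so the worst case is [j = 2m = N - 2], where the node is
    [pi - 2 pi/N] and its cosine is [2 sin(pi/N)^2 - 1]. *)
Let cos_node j : (j <= 2 * m)%N -> 8 - N ^+ 2 <= N ^+ 2 * cos (node j).
Proof.
move=> jm.
have inpi k : (k <= 2 * m + 2)%N -> node k \in `[0, pi].
  by move=> k2; rewrite in_itv /= -[X in X <= _]node0 -node_pi !node_le.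
have c1 : cos (node (2 * m)) <= cos (node j).
  rewrite leNgt ltr_cos ?inpi -?leNgt ?node_le //; lia.
have c2 : cos (node (2 * m)) = 2 * sin (node 1) ^+ 2 - 1.
  have -> : node (2 * m) = pi - node 1 *+ 2.
    rewrite -node_pi /node natrD; field.
    by rewrite gt_eqF.
  by rewrite cosB cospi sinpi mul0r addr0 cos_mulr2n cos2sin2; ring.
have := sin_node1; set s := sin _ in c2 *; move=> hs.
have : 4 <= (N * s) ^+ 2 by nra.
rewrite exprMn => h4.
have N2 : 0 <= N ^+ 2 by rewrite sqr_ge0.
have := ler_wpM2l N2 c1; rewrite c2 => h5.
nra.
Qed.

Lemma amplitude_node_sign j : (j <= 2 * m)%N -> 0 < (-1) ^+ j * amplitude m (node j).
Proof.
move=> jm; rewrite amplitudeE -/N.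
have -> : N * node j = j%:R * pi by rewrite /node; field; rewrite gt_eqF.
rewrite sin_natMpi cos_natMpi mulr0 addr0.
have sq : (-1) ^+ j * (-1) ^+ j = 1 :> R by rewrite -expr2 sqrr_sign.
have signE A B : (-1) ^+ j * (A + 4 * B * (-1) ^+ j) =
    (-1) ^+ j * A + 4 * B * ((-1) ^+ j * (-1) ^+ j) :> R by ring.
rewrite signE sq mulr1.
have := cos_node jm; set c := cos _; set x := N ^+ 2 => hc.
have x0 : 4 <= x.
  have : (2 : R) <= N by rewrite ler_nat; lia.
  rewrite /x; nra.
(* Inserting [x c >= 8 - x] makes the quadratic terms cancel. Four times this bound exceeds
   [16 x - 4], so the term with the sign [(-1)^j] dominates. *)
have hb : 4 * x + 17 <= x * (x + 2) * c + (x - 1) ^+ 2 by nra.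
have : - (16 * x - 4) <= (-1) ^+ j * (16 * x - 4).
  by case: (odd j) (signr_odd R j) => <-; rewrite ?expr1 ?expr0; lra.
lra.
Qed.

Lemma amplitude_zero_between j : (j < 2 * m)%N ->
  exists2 z, node j < z < node j.+1 & amplitude m z = 0.
Proof.
move=> jm; have s1 := amplitude_node_sign (ltnW jm).
have s2 := amplitude_node_sign jm; rewrite exprS mulN1r in s2.
have [] := @IVT R (amplitude m) (node j) (node j.+1) 0.
- exact: node_le.
- exact/continuous_subspaceT/continuous_amplitude.
- rewrite ge_min le_max.
  by case: (odd j) (signr_odd R j) s1 s2 => <-; rewrite ?expr1 ?expr0; lra.
move=> z; rewrite in_itv /= => /andP[z1 z2] z0; exists z => //.
(* The intermediate value theorem gives a closed interval; the strict signs at the nodes exclude its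
   endpoints. *)
rewrite !lt_neqAle z1 z2 !andbT; apply/andP; split; apply/eqP => E.
  by move: s1; rewrite E z0 mulr0 ltxx.
by move: s2; rewrite -E z0 mulr0 ltxx.
Qed.

Lemma amplitude_zeros : exists s : seq R, [/\ uniq s, size s = (2 * m)%N &
  forall t, t \in s <-> 0 < t < pi /\ amplitude m t = 0].
Proof.
have /choice[z zP] : forall j, exists z,
    (j < 2 * m)%N -> node j < z < node j.+1 /\ amplitude m z = 0.
  move=> j; case: (ltnP j (2 * m)) => [/amplitude_zero_between[z]|]; last by exists 0.
  by exists z.
pose s := [seq z j | j <- iota 0 (2 * m)].
have us : uniq s.
  have z_lt i j : (i < j)%N -> (j < 2 * m)%N -> z i < z j.
    move=> ij jm; have [/andP[_ h1] _] := zP _ (ltn_trans ij jm).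
    have [/andP[h2 _] _] := zP _ jm.
    exact: lt_trans h1 (le_lt_trans (node_le ij) h2).
  rewrite map_inj_in_uniq ?iota_uniq // => i j; rewrite !mem_iota /= add0n => im jm zij.
  case: (ltngtP i j) => // [/z_lt/(_ jm)|/z_lt/(_ im)]; by rewrite zij ltxx.
have ss : size s = (2 * m)%N by rewrite size_map size_iota.
have sP t : t \in s -> 0 < t < pi /\ amplitude m t = 0.
  case/mapP => j; rewrite mem_iota add0n => /= /[dup] jm /zP[/andP[h1 h2] h0] ->.
  split=> //; apply/andP; split; first by rewrite (le_lt_trans _ h1) // -node0 node_le.
  by rewrite (lt_le_trans h2) // -node_pi node_le //; lia.
exists s; split=> // t; split=> [/sP//|[t0pi at0]].
have [q [sq qE]] := amplitude_cos R m.
have cos_gtN1 x : 0 < x < pi -> 0 < cos x + 1.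
  move=> /andP[x0 xpi]; rewrite -(opprK 1) subr_gt0 -cospi ltr_cos //;
    by rewrite in_itv /= ?pi_ge0 ?lexx // !ltW.
have q_neq0 : q != 0.
  apply/eqP => q0; have := qE 0; rewrite q0 horner0 mulr0 => /eqP.
  by rewrite mulf_eq0 pnatr_eq0 /= gt_eqF ?amplitude0_gt0.
have q_root x : 0 < x < pi -> amplitude m x = 0 -> root q (cos x).
  move=> xpi ax; have := qE x; rewrite ax mulr0 => /esym/eqP.
  by rewrite mulf_eq0 expf_eq0 /= gt_eqF ?cos_gtN1.
(* A further zero would give [q] at least [2m + 1] distinct roots, as cosine is injective on
   [[0, pi]], but its degree is at most [2m]. *)
apply/negPn/negP => ts.
have cos_inj' : {in t :: s &, injective (@cos R)}.
  have pi_of x : x \in t :: s -> x \in `[0, pi].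
    rewrite inE in_itv /= => /predU1P[->|/sP[/andP[x0 xpi] _]]; last by rewrite !ltW.
    by case/andP: t0pi => x0 xpi; rewrite !ltW.
  by move=> x y /pi_of xp /pi_of yp; exact: cos_inj.
have := @max_poly_roots _ q [seq cos x | x <- t :: s] q_neq0.
rewrite map_inj_in_uniq // cons_uniq ts us size_map /= ss => /(_ _ isT) h.
have : (size q <= 2 * m + 1)%N by [].
rewrite leqNgt addn1 h //=; apply/andP; split; first exact: q_root.
by apply/allP => _ /mapP[x /sP[xpi ax] ->]; exact: q_root.
Qed.

End AmplitudeZeros.

(** * The spectrum {0, +-(2m+1), +-(2m+2), +-(2m+3)} *)

Section Triplet.
Local Open Scope complex_scope.
Variables (R : realType) (m : nat).
Hypothesis m_gt0 : (1 <= m)%N.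

Definition spectrum : seq R :=
  [:: 0; (2 * m + 1)%:R; - (2 * m + 1)%:R; (2 * m + 2)%:R;
      - (2 * m + 2)%:R; (2 * m + 3)%:R; - (2 * m + 3)%:R].

Let lam (k : 'I_7) : R := spectrum`_k.
Let N : R := (2 * m + 2)%:R.

Let spectrumE : spectrum = [:: 0; N - 1; - (N - 1); N; - N; N + 1; - (N + 1)].
Proof.
have -> : N - 1 = (2 * m + 1)%:R by rewrite /N !natrD; ring.
by have -> : N + 1 = (2 * m + 3)%:R by rewrite /N !natrD; ring.
Qed.

Let N_ge4 : 4 <= N.
Proof. by rewrite /N ler_nat; lia. Qed.

Lemma spectrum_inj : injective lam.
Proof.
have us : uniq spectrum.
  rewrite spectrumE /= !inE !negb_or; move: N_ge4; set x := N => x4.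
  by repeat (apply/andP; split => //); apply/eqP; lra.
by move=> i j /eqP; rewrite nth_uniq // => /eqP/val_inj.
Qed.

(** The characteristic polynomial is odd, so its derivative is even and takes equal values at
    opposite eigenvalues. *)
Lemma node_factorE k : node_factor lam k = [:: 
   - ((N - 1) ^+ 2 * N ^+ 2 * (N + 1) ^+ 2);
   8 * N * (2 * N - 1) * (N - 1) ^+ 2; 8 * N * (2 * N - 1) * (N - 1) ^+ 2;
   - (2 * N ^+ 2 * (4 * N ^+ 2 - 1)); - (2 * N ^+ 2 * (4 * N ^+ 2 - 1));
   8 * N * (2 * N + 1) * (N + 1) ^+ 2; 8 * N * (2 * N + 1) * (N + 1) ^+ 2]`_k.
Proof.
have lamE i : lam i = [:: 0; N - 1; - (N - 1); N; - N; N + 1; - (N + 1)]`_i.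
  by rewrite /lam spectrumE.
case: k; do 7 (case; [
  by move=> ?; rewrite /node_factor big_mkcond !big_ord_recl big_ord0 !lamE /=; ring |]).
by [].
Qed.

(** The signs alternate along the increasingly ordered eigenvalues, as for a derivative at
    consecutive simple roots. *)
Lemma sg_node_factor k :
  Num.sg (node_factor lam k) = [:: -1; 1; 1; -1; -1; 1; 1]`_k.
Proof.
rewrite node_factorE; move: N_ge4; set x := N => x4.
have sq_gt0 (y : R) : 0 < y -> 0 < y ^+ 2 by move=> y0; rewrite exprn_gt0.
have h1 : 0 < (x - 1) ^+ 2 by apply: sq_gt0; lra.
have h2 : 0 < x ^+ 2 by apply: sq_gt0; lra.
have h3 : 0 < (x + 1) ^+ 2 by apply: sq_gt0; lra.
have d1 := mulr_gt0 (mulr_gt0 h1 h2) h3.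
have d2 : 0 < 8 * x * (2 * x - 1) * (x - 1) ^+ 2 by apply: mulr_gt0 => //; nra.
have d3 : 0 < 2 * x ^+ 2 * (4 * x ^+ 2 - 1) by apply: mulr_gt0; nra.
have d4 : 0 < 8 * x * (2 * x + 1) * (x + 1) ^+ 2 by apply: mulr_gt0 => //; nra.
by case: k; do 7 (case; [by move=> ? /=; rewrite ?sgrN gtr0_sg|]).
Qed.

(** Opposite eigenvalues carry equal weights, so the sines cancel and the cosines double. *)
Lemma spectral_sum t :
  \sum_k (`|node_factor lam k|^-1)%:C * expi (- (lam k * t)) =
  (amplitude m t / (4 * N ^+ 2 * (4 * N ^+ 2 - 1) * (N - 1) ^+ 2 * (N + 1) ^+ 2))%:C.
Proof.
rewrite !big_ord_recl big_ord0 !normrEsg !sg_node_factor !node_factorE /lam /spectrum /=.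
rewrite /amplitude -/N /expi !mulNr !opprK !cosN !sinN mul0r cos0 sin0.
move: N_ge4; set x := N => x4.
set c1 := cos _; set c2 := cos _; set c3 := cos _.
clearbody c1 c2 c3 x.
apply/eqP; rewrite eq_complex /=; apply/andP; split; apply/eqP; last by ring.
have n1 : x != 0 by apply/eqP; lra.
have n2 : x - 1 != 0 by apply/eqP; lra.
have n3 : x + 1 != 0 by apply/eqP; lra.
have n4 : 2 * x - 1 != 0 by apply/eqP; lra.
have n5 : 2 * x + 1 != 0 by apply/eqP; lra.
have n6 : 4 * x ^+ 2 - 1 != 0.
  have -> : 4 * x ^+ 2 - 1 = (2 * x - 1) * (2 * x + 1) by ring.
  by rewrite mulf_neq0.
by field; rewrite ?n1 ?n2 ?n3 ?n4 ?n5 ?n6.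
Qed.

Variables (a : 'I_7 -> R) (b : 'I_6 -> R).
Hypothesis b_gt0 : forall k, 0 < b k.
Hypothesis lam_eig : forall k, eigenvalue (jacobi a b) (lam k).

(** The eigenvalue 0 forces [expi phi = -1]. The eigenvalues [2m+1] and [2m+2], at positions 1 and
    3, differ by one and have opposite signs, which forces [expi (- T) = -1]. *)
Lemma PST_at_cos T : PST_at (jacobi a b) T -> cos T = -1.
Proof.
move=> /(PST_at_phase b_gt0 spectrum_inj lam_eig)[phi [ph _]].
have p0 := ph 0; have p1 := ph (inord 1); have p3 := ph (inord 3).
rewrite !sg_node_factor /lam !inordK //= in p0 p1 p3.
have phiE : expi phi = -1.
  by move: p0; rewrite mul0r oppr0 expi0 rmorphN rmorph1 mulrN1 => ->; rewrite opprK.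
have : expi (- ((2 * m + 2)%:R * T)) = expi (- ((2 * m + 1)%:R * T)) * expi (- T).
  by rewrite -expiD; congr expi; rewrite !natrD; ring.
rewrite p1 p3 phiE rmorphN !rmorph1 mulrN1 mulr1 opprK mulN1r => /(congr1 (@complex.Re R)).
by rewrite /= cosN => ->; rewrite opprK.
Qed.

(** At [pi] the phase of an integer eigenvalue is its parity sign, and the odd eigenvalues are
    exactly those with positive [node_factor]. *)
Lemma PST_at_pi T : PST_at (jacobi a b) T -> PST_at (jacobi a b) pi.
Proof.
move=> PT; apply: (PST_at_of_phase b_gt0 spectrum_inj lam_eig (phi := pi) PT).
  exact: pi_gt0.
have expiN k : expi (- (k%:R * pi)) = (-1) ^+ k :> R[i].
  by rewrite -expi_natMpi /expi cosN sinN sin_natMpi oppr0.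
have -> : expi pi = -1 :> R[i] by rewrite -[pi]mul1r (expi_natMpi R 1).
have sgn e : (-1) ^+ (2 * m + e) = (-1) ^+ e :> R[i].
  by rewrite exprD exprM sqrrN !expr1n mul1r.
move=> k; rewrite sg_node_factor /lam /spectrum.
by case: k; do 7 (case; [move=> ? /=;
  rewrite ?mulNr ?opprK ?mul0r ?oppr0 ?expi0 ?expiN ?expi_natMpi ?sgn ?rmorphN ?rmorph1;
  ring|]).
Qed.

(** A time before [pi] has cosine above [-1]; a time after [pi] is not the earliest. *)
Lemma earliest_PST_pi T : earliest_PST (jacobi a b) T -> T = pi.
Proof.
move=> [PT first]; have [T0 _] := PT.
have [Tpi|piT|//] := ltgtP T pi; last first.
  by case: (first pi); [rewrite pi_gt0 | exact: PST_at_pi PT].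
have : cos pi < cos T.
  by rewrite ltr_cos // in_itv /= ?pi_ge0 ?lexx // !ltW.
by rewrite cospi (PST_at_cos PT) ltxx.
Qed.

End Triplet.

Theorem theorem3p4 (R : realType) (m : nat) (hm : (1 <= m)%N)
  (a : 'I_7 -> R) (b : 'I_6 -> R) (hb : forall k, 0 < b k) :
  realizes_PST (jacobi a b) ->
  (forall x : R, eigenvalue (jacobi a b) x <->
     x \in [:: 0; (2 * m + 1)%:R; - (2 * m + 1)%:R; (2 * m + 2)%:R;
               - (2 * m + 2)%:R; (2 * m + 3)%:R; - (2 * m + 3)%:R]) ->
  forall T : R, earliest_PST (jacobi a b) T ->
  exists s : seq R, [/\ uniq s, size s = (2 * m)%N &
    forall tau : R, tau \in s <-> ESE_at (jacobi a b) T tau].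
Proof.
move=> _ spec T ET.
have lam_eig (k : 'I_7) : eigenvalue (jacobi a b) (spectrum R m)`_k.
  by apply/spec/mem_nth.
rewrite (earliest_PST_pi hm hb lam_eig ET).
have [PT _] := ET; have [s [us ss sP]] := amplitude_zeros R m.
exists s; split=> // tau; rewrite sP.
(* The return amplitude is a positive multiple of [amplitude m tau], so the two have the same
   zeros. *)
suff ampE : cdot (expmi (jacobi a b) tau *m evec ord0) (evec ord0) = 0 <->
    amplitude m tau = 0 :> R by split=> -[? /ampE].
rewrite (return_amplitude hb (spectrum_inj hm) lam_eig tau PT) (spectral_sum hm).
have N4 : 4 <= (2 * m + 2)%:R :> R by rewrite ler_nat; lia.
have := corner_gt0 a hb; set c := fun_of_matrix _ ord0 ord_max => c0.
set x : R := (2 * m + 2)%:R in N4 *.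
split=> [/eqP|->]; last by rewrite mul0r mulr0.
rewrite -rmorphM fmorph_eq0 !mulf_eq0 invr_eq0 (gt_eqF c0) /= => /orP[/eqP//|].
rewrite gt_eqF // !mulr_gt0 ?exprn_gt0 //; nra.
Qed.
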